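(* Let $E,F$ be FS spaces represented as projective limits of nested compact sequences of Banach spaces, $E=\varprojlim E_k$ and $F=\varprojlim F_k$ ($k\in\mathbb{N}_0$). Let $P:(E_0,E)\to(F^\sharp,F)$ be a map of pairs of topological vector spaces, with $F^\sharp$ Hausdorff. If $P$ satisfies property $(\mathcal{H}')$, then the range of $P:E\to F$ is closed in $F$.
   Context: A nested compact sequence of Banach spaces is a sequence $\{E_k\}_{k\in\mathbb{N}_0}$ of Banach spaces with injective compact linear maps $E_{k+1}\hookrightarrow E_k$, regarded as inclusions $E_{k+1}\subset E_k$; its projective limit is $E=\bigcap_kE_k$ with the coarsest locally convex topology making every inclusion $E\hookrightarrow E_k$ continuous. An FS (Fréchet–Schwartz) space is a projective limit of a compact sequence of locally convex (equivalently Banach) spaces. A pair of topological vector spaces $(E^\sharp,E)$ consists of a topological vector space $E^\sharp$ and a linear subspace $E\subset E^\sharp$ endowed with a vector topology finer than the one induced by $E^\sharp$. A map of pairs $P:(E^\sharp,E)\to(F^\sharp,F)$ is a continuous linear map $P:E^\sharp\to F^\sharp$ such that $P(E)\subset F$ and the induced map $P:E\to F$ is continuous. $P$ satisfies property $(\mathcal{H}')$ if: whenever $u\in E^\sharp$ and $Pu\in F$, there exists $v\in E$ such that $Pu=Pv$. (In the claim, $E^\sharp=E_0$.) *)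

(* Defs.v *)
From HB Require Import structures.
From mathcomp Require Import all_boot all_order all_algebra.
From mathcomp Require Import all_classical all_reals all_analysis.
From mathcomp Require Export complex.

Set Implicit Arguments.
Unset Strict Implicit.
Unset Printing Implicit Defensive.

Import Order.TTheory GRing.Theory Num.Theory numFieldNormedType.Exports.
Local Open Scope classical_set_scope.
Local Open Scope ring_scope.

(* [precompact A] is the library's "closure A is compact" ([precompactE]). *)
Definition compact_linear (K : numFieldType) (V W : normedModType K)
  (T : {linear V -> W}) : Prop := precompact (T @` [set x | `|x| <= 1]).

Record nested_compact_seq (K : numFieldType) := NestedCompactSeq {
  step :> nat -> completeNormedModType K ;
  emb : forall k, {linear step k.+1 -> step k} ;
  emb_inj : forall k, injective (emb k) ;
  emb_compact : forall k, compact_linear (emb k) }.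

Section projective_limit.
Context {K : numFieldType} (E : nested_compact_seq K).

(* The spaces [E k] are related by injections and not by actual inclusions, so
   a point of the intersection is given by its copies in all the [E k]; see
   [proj0_inj] and [range_proj0] below. *)
Record projlim : Type := Projlim {
  pr : forall k, E k ;
  emb_pr : forall k, emb E k (pr k.+1) = pr k }.

Lemma projlim_eq (x y : projlim) : (forall k, pr x k = pr y k) -> x = y.
Proof.
case: x y => [x xP] [y yP] /= xy.
have {}xy : x = y by exact/functional_extensionality_dep.
by subst y; congr Projlim; exact: Prop_irrelevance.
Qed.

HB.instance Definition _ := gen_eqMixin projlim.
HB.instance Definition _ := gen_choiceMixin projlim.

Program Definition projlim_zero := @Projlim (fun k => 0) _.
Next Obligation. by move=> *; rewrite linear0. Qed.

Program Definition projlim_opp (x : projlim) := @Projlim (fun k => - pr x k) _.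
Next Obligation. by move=> *; rewrite linearN emb_pr. Qed.

Program Definition projlim_add (x y : projlim) :=
  @Projlim (fun k => pr x k + pr y k) _.
Next Obligation. by move=> *; rewrite linearD !emb_pr. Qed.

Program Definition projlim_scale (a : K) (x : projlim) :=
  @Projlim (fun k => a *: pr x k) _.
Next Obligation. by move=> *; rewrite linearZ_LR emb_pr. Qed.

Let projlim_addA : associative projlim_add.
Proof. by move=> x y z; apply: projlim_eq => k /=; rewrite addrA. Qed.

Let projlim_addC : commutative projlim_add.
Proof. by move=> x y; apply: projlim_eq => k /=; rewrite addrC. Qed.

Let projlim_add0 : left_id projlim_zero projlim_add.
Proof. by move=> x; apply: projlim_eq => k /=; rewrite add0r. Qed.

Let projlim_addN : left_inverse projlim_zero projlim_opp projlim_add.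
Proof. by move=> x; apply: projlim_eq => k /=; rewrite addNr. Qed.

HB.instance Definition _ := GRing.isZmodule.Build projlim
  projlim_addA projlim_addC projlim_add0 projlim_addN.

Let projlim_scaleA a b (x : projlim) :
  projlim_scale a (projlim_scale b x) = projlim_scale (a * b) x.
Proof. by apply: projlim_eq => k /=; rewrite scalerA. Qed.

Let projlim_scale1 : left_id 1 projlim_scale.
Proof. by move=> x; apply: projlim_eq => k /=; rewrite scale1r. Qed.

Let projlim_scaleDr : right_distributive projlim_scale +%R.
Proof. by move=> a x y; apply: projlim_eq => k /=; rewrite scalerDr. Qed.

Let projlim_scaleDl (x : projlim) :
  {morph projlim_scale^~ x : a b / a + b}.
Proof. by move=> a b; apply: projlim_eq => k /=; rewrite scalerDl. Qed.

HB.instance Definition _ := GRing.Zmodule_isLmodule.Build K projlim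
  projlim_scaleA projlim_scale1 projlim_scaleDr projlim_scaleDl.

Definition proj (k : nat) (x : projlim) : E k := pr x k.

Let proj_is_linear k : linear (proj k).
Proof. by []. Qed.

HB.instance Definition _ k :=
  GRing.isLinear.Build K projlim (E k) *:%R (proj k) (@proj_is_linear k).

(* The coarsest topology making all the maps [proj k] continuous; it is locally
   convex (see the [Tvs] instance below), so it is also the coarsest locally
   convex one. *)
HB.instance Definition _ := Topological.copy projlim
  (sup_topology (fun k => Topological.class (initial_topology (proj k)))).

Lemma cvg_projlim (G : set_system projlim) (x : projlim) : Filter G ->
  G --> x <-> forall k, proj k @ G --> proj k x.
Proof.
move=> FG; rewrite cvg_sup; split=> H k.
  apply: cvg_trans (cvg_app (proj k) (H k)) _.
  exact: (@initial_continuous _ _ (proj k) x).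
move=> A /= [B [[C oC <-] Cx] CA]; apply: (filterS CA).
by apply: (H k C); exact: open_nbhs_nbhs.
Qed.

Lemma proj_continuous k : continuous (proj k).
Proof. by move=> x; apply: (cvg_projlim x (nbhs_filter x)).1. Qed.

Let projlim_add_continuous : continuous (fun z : projlim * projlim => z.1 + z.2).
Proof.
move=> z; apply/cvg_projlim => k.
have c1 : proj k w.1 @[w --> z] --> proj k z.1.
  apply: (@cvg_comp _ _ _ fst (proj k) _ (nbhs z.1)); first exact: cvg_fst.
  exact: proj_continuous.
have c2 : proj k w.2 @[w --> z] --> proj k z.2.
  apply: (@cvg_comp _ _ _ snd (proj k) _ (nbhs z.2)); first exact: cvg_snd.
  exact: proj_continuous.
exact: cvgD c1 c2.
Qed.

Let projlim_scale_continuous : continuous (fun z : K^o * projlim => z.1 *: z.2).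
Proof.
move=> z; apply/cvg_projlim => k.
have c1 : w.1 @[w --> z] --> z.1 by exact: cvg_fst.
have c2 : proj k w.2 @[w --> z] --> proj k z.2.
  apply: (@cvg_comp _ _ _ snd (proj k) _ (nbhs z.2)); first exact: cvg_snd.
  exact: proj_continuous.
exact: cvgZ c1 c2.
Qed.

Let projlim_locally_convex :
  exists2 B : set_system projlim, (forall b, b \in B -> convex_set b) & basis B.
Proof.
exists [set U | open U /\ convex_set U] => [U|]; first by rewrite inE => -[].
split=> [U []//|x]; set G := filter_from _ _.
have FG : Filter G.
  apply: filter_from_filter.
    exists setT; split=> //.
    by split; [exact: openT|move=> a b l _ _; exact: mem_set].
  move=> U V [[oU cU] Ux] [[oV cV] Vx]; exists (U `&` V) => //; split=> //.
  split; first exact: openI.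
  move=> a b l /set_mem[Ua Va] /set_mem[Ub Vb]; apply: mem_set.
  by split; apply: set_mem; [apply: cU|apply: cV]; exact: mem_set.
apply/cvg_projlim => k C xC.
have [Bk Bcv [Bo Bb]] := @locally_convex K (E k).
have [V [BV Vx] VC] := Bb _ _ xC.
exists (proj k @^-1` V); last by move=> y /= /VC.
split=> //; split.
  by apply: open_comp (Bo _ BV) => y _; exact: proj_continuous.
move=> a b l /set_mem Va /set_mem Vb; apply: mem_set; apply: set_mem.
exact: (Bcv V (mem_set BV) (proj k a) (proj k b) l (mem_set Va) (mem_set Vb)).
Qed.

HB.instance Definition _ := PreTopologicalLmod_isTvs.Build K projlim
  projlim_add_continuous projlim_scale_continuous projlim_locally_convex.

HB.instance Definition _ := PreTopologicalNmodule_isTopologicalNmodule.Build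
  projlim projlim_add_continuous.
HB.instance Definition _ := TopologicalNmodule_isTopologicalLmodule.Build
  K projlim projlim_scale_continuous.
HB.instance Definition _ := Uniform_isTvs.Build K projlim projlim_locally_convex.

Fixpoint to_base (k : nat) : E k -> E 0 :=
  if k is k'.+1 then fun x => to_base (emb E k' x) else id.

Lemma proj0_inj : injective (proj 0).
Proof.
move=> x y xy; apply: projlim_eq; elim=> [//|k IH].
by apply: (@emb_inj _ E k); rewrite !emb_pr.
Qed.

Lemma range_proj0 : range (proj 0) = \bigcap_k range (@to_base k).
Proof.
apply/seteqP; split=> [_ [x _ <-] k _|u uE].
  by exists (proj k x) => //; elim: k => //= k <-; rewrite emb_pr.
have fk k : {y : E k | to_base y = u}.
  by apply: cid; have [y _ yu] := uE k I; exists y.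
pose f k := sval (fk k); have fE k : to_base (f k) = u := svalP (fk k).
have to_base_inj k : injective (@to_base k).
  by elim: k => //= k IH a b /IH /(@emb_inj _ E k).
have fP k : emb E k (f k.+1) = f k.
  by apply: to_base_inj; rewrite fE -[RHS](fE k.+1).
by exists (Projlim fP); rewrite // -(fE 0).
Qed.

End projective_limit.

Arguments proj {K} E k.

(* A linear subspace with a topology finer than the induced one, encoded by its
   inclusion map. *)
Record tvs_pair (K : numFieldType) (Esharp E : topologicalLmodType K) := TvsPair {
  incl :> {linear E -> Esharp} ;
  incl_inj : injective incl ;
  incl_continuous : continuous incl }.

Definition projlim_pair (K : numFieldType) (E : nested_compact_seq K) :
    tvs_pair (E 0) (projlim E) :=
  TvsPair (@proj0_inj K E) (@proj_continuous K E 0).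

(* [map_ind] is determined by [map_sharp], since [j] is injective; that it exists
   and satisfies [map_indE] says that [map_sharp] sends [E] into [F]. *)
Record pair_map (K : numFieldType)
    (Esharp E Fsharp F : topologicalLmodType K)
    (i : tvs_pair Esharp E) (j : tvs_pair Fsharp F) := PairMap {
  map_sharp :> {linear Esharp -> Fsharp} ;
  map_ind : {linear E -> F} ;
  map_indE : forall v, map_sharp (i v) = j (map_ind v) ;
  map_sharp_continuous : continuous map_sharp ;
  map_ind_continuous : continuous map_ind }.

Definition property_H' (K : numFieldType)
    (Esharp E Fsharp F : topologicalLmodType K)
    (i : tvs_pair Esharp E) (j : tvs_pair Fsharp F) (P : pair_map i j) : Prop :=
  forall u : Esharp, range j (P u) -> exists v : E, P u = P (i v).

(* Main.v *)
(* The graph G of P in E_0 x F is complete since F^# is Hausdorff. By (H'), every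
   Pu in F is P of a point of E_1, and the unit ball of E_1 has compact closure
   in E_0; Baire's theorem on G thus gives a compact set C of E_0 such that
   (u, f) in G lies in E_0 x P(C) as soon as u and f are small. Compactness of C also shows that the smallness of u can be
   dropped: the preimages in C of a small enough f are close to ker P. So for
   some neighbourhood U of 0 in F, the intersection of P(E) with U is contained
   in P(C), whose trace on F is closed. If f is in the closure of P(E), choose
   Pv near f; then f - Pv is in P(C), so f is in P(E_0), and (H') puts f in P(E). *)

Require Import Defs.
From mathcomp Require Import all_boot all_order all_algebra.
From mathcomp Require Import all_classical all_reals all_analysis complex.

Import Order.TTheory GRing.Theory Num.Theory numFieldNormedType.Exports.
Local Open Scope classical_set_scope.
Local Open Scope ring_scope.

(** * Archimedean scalars, covering the real and the complex case at once *)

Definition archimedean (K : numDomainType) : Prop :=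
  forall x : K, 0 <= x -> exists n : nat, x <= n%:R.

Lemma archimedean_realType (R : realType) : archimedean (R : numFieldType).
Proof. by move=> x _; exists (Num.truncn x).+1; rewrite ltW// truncnS_gt. Qed.

Lemma archimedean_complex (R : realType) :
  archimedean (R[i]%C : numFieldType).
Proof.
move=> x x0; exists (Num.truncn (complex.Re x)).+1.
rewrite -[x]RRe_real ?ger0_real// -(rmorph_nat (real_complex R)) lecR.
by rewrite ltW// truncnS_gt.
Qed.

Lemma archimedean_pow2 (K : numFieldType) : archimedean K ->
  forall e : K, 0 < e -> exists n : nat, 2 ^- n <= e.
Proof.
move=> arch e e0.
have [|n en] := arch e^-1; first by rewrite invr_ge0 ltW.
exists n.
rewrite -[e]invrK lef_pV2 ?posrE ?invr_gt0 ?exprn_gt0//.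
apply: (le_trans en).
by rewrite -natrX ler_nat ltnW// ltn_expl.
Qed.

(* Baire's theorem in a form that needs no topology: [B] plays the role of a
   countable basis of neighbourhoods of [0] in the complete group [G], and the
   [A n] are closed sets covering [G]. *)
Lemma baire_zmod (X : zmodType) (G : set X) (B A : nat -> set X) :
    G 0 ->
    (forall n, B n 0) ->
    (forall n x y, B n.+1 x -> B n.+1 y -> B n (x + y)) ->
    (forall x m, (forall n, G (x n)) -> (forall n, (n <= m n)%N) ->
       (forall n p, B (m n) (x (n + p)%N - x n)) ->
       exists2 l, G l & forall n, B (m n) (l - x n)) ->
    (forall n x, G x -> ~ A n x ->
       exists m, forall y, G y -> B m (y - x) -> ~ A n y) ->
    (forall x, G x -> exists n, A n x) ->
  exists n x m, G x /\ forall y, G y -> B m (y - x) -> A n y.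
Proof.
move=> G0 B0 BD cplt clA covA; apply: contrapT => noint.
have Bs n x : B n.+1 x -> B n x by move=> /(BD _ _ _ (B0 _)); rewrite add0r.
have Ble n m x : (n <= m)%N -> B m x -> B n x.
  move=> /subnKC <-; elim: (m - n)%N => [|k IH]; rewrite ?addn0// addnS.
  by move/Bs/IH.
(* Membership in [G] is a premise inside the existential so that [choice] applies to all [a]; points
   outside [G] get a dummy value. *)
have stepP (a : nat * (X * nat)) : exists b : X * nat, G a.2.1 ->
    [/\ G b.1, B a.2.2.+1 (b.1 - a.2.1), (a.2.2 < b.2)%N &
        forall y, G y -> B b.2 (y - b.1) -> ~ A a.1 y].
  case: a => n [x m] /=; have [Gx|nGx] := pselect (G x); last by exists (0, 0%N).
  have [y [Gy Bxy nAy]] : exists y, [/\ G y, B m.+1 (y - x) & ~ A n y].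
    apply: contrapT => H; apply: noint; exists n, x, m.+1; split=> // y Gy Bxy.
    by apply: contrapT => nAy; apply: H; exists y.
  have [k kP] := clA n y Gy nAy.
  exists (y, maxn m.+1 k) => _; split=> //=; first exact: leq_maxl.
  by move=> z Gz Bz; apply: kP => //; apply: Ble Bz; exact: leq_maxr.
have [f fP] := choice stepP.
(* The neighbourhood in [G] attached to [s n.+1] avoids [A n]; the limit of the points lies in all
   these neighbourhoods, hence in no [A n]. *)
pose fix s n := if n is p.+1 then f (p, s p) else (0, 0%N).
have Gs n : G (s n).1 by elim: n => //= n IH; have [] := fP (n, s n) IH.
have sS n : B (s n).2.+1 ((s n.+1).1 - (s n).1) by have [] := fP (n, s n) (Gs n).
have ltm n : ((s n).2 < (s n.+1).2)%N by have [] := fP (n, s n) (Gs n).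
have lem n : (n <= (s n).2)%N by elim: n => // n IH; exact: leq_ltn_trans (ltm n).
have cauchys n p : B (s n).2 ((s (n + p)%N).1 - (s n).1).
  elim: p n => [|p IH] n; first by rewrite addn0 subrr.
  rewrite addnS -addSn -(subrKA (s n.+1).1); apply: BD => //.
  exact: Ble (ltm n) (IH n.+1).
have [l Gl lP] := cplt (fun n => (s n).1) (fun n => (s n).2) Gs lem cauchys.
have [n Al] := covA l Gl.
by have [_ _ _ /(_ l Gl (lP n.+1))] := fP (n, s n) (Gs n).
Qed.

(* [all_analysis] has its own [proj]. *)
Local Notation proj := Defs.proj.

(** One index sets both the number of norms and the radius, so that a single sequence is a basis at
    [0]. *)
Definition projlim_ball {K : numFieldType} (F : nested_compact_seq K) (m : nat) :
    set (projlim F) :=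
  [set f | forall k, (k <= m)%N -> `|proj F k f| <= 2 ^- m].

(** * Neighbourhoods of [0] in the projective limit *)

Section projlim_ball.
Context {K : numFieldType} (F : nested_compact_seq K).

Lemma projlim_ball0 m : projlim_ball F m 0.
Proof. by move=> k _; rewrite linear0 normr0 invr_ge0 exprn_ge0. Qed.

Lemma pow2V_double (m : nat) : 2 ^- m.+1 + 2 ^- m.+1 = 2 ^- m :> K.
Proof. by rewrite exprS invfM -mulrDl -[2^-1]mul1r -splitr mul1r. Qed.

Lemma ler_pow2V m n : (m <= n)%N -> 2 ^- n <= 2 ^- m :> K.
Proof.
by move=> mn; rewrite lef_pV2 ?posrE ?exprn_gt0// ler_eXn2l// ltr1n.
Qed.

Lemma projlim_ballD m f g :
  projlim_ball F m.+1 f -> projlim_ball F m.+1 g -> projlim_ball F m (f + g).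
Proof.
move=> Bf Bg k km; rewrite linearD (le_trans (ler_normD _ _))//.
by rewrite -pow2V_double lerD// ?(Bf, Bg)// leqW.
Qed.

Lemma projlim_ball_le m n f : (m <= n)%N ->
  projlim_ball F n f -> projlim_ball F m f.
Proof.
move=> mn Bf k km; rewrite (le_trans (Bf k (leq_trans km mn)))//.
exact: ler_pow2V.
Qed.

Lemma projlim_ballN m f : projlim_ball F m f -> projlim_ball F m (- f).
Proof. by move=> Bf k km; rewrite linearN normrN Bf. Qed.

Lemma projlim_ball_half m f : projlim_ball F m f -> projlim_ball F m (2^-1 *: f).
Proof.
move=> Bf k km; rewrite linearZ_LR normrZ (le_trans _ (Bf k km))//.
rewrite ler_piMl// ger0_norm ?invr_ge0// invf_le1 ?ler1n//.
Qed.

Lemma projlim_ball_basis (x : projlim F) (U : set (projlim F)) :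
    archimedean K -> nbhs x U ->
  exists m, forall y, projlim_ball F m (y - x) -> U y.
Proof.
move=> arch xU; pose G := filter_from [set: nat]
  (fun m => [set y | projlim_ball F m (y - x)]).
suff : G --> x by move=> /(_ U xU)[m _ mU]; exists m => y /mU.
have FG : Filter G.
  apply: filter_from_filter; first by exists 0%N.
  move=> i j _ _; exists (maxn i j) => // y By.
  by split; apply: projlim_ball_le By; rewrite ?leq_maxl ?leq_maxr.
apply/cvg_projlim => k; apply/cvgrPdist_le => e e0.
have [n ne] := archimedean_pow2 K arch e e0.
(* Index [k] brings in the norm of [F k], and [n] makes the radius at most [e]. *)
exists (maxn k n) => // y /= By; rewrite distrC -linearB.
rewrite (le_trans (By k (leq_maxl _ _)))// (le_trans _ ne)//.
by apply: ler_pow2V; exact: leq_maxr.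
Qed.

Lemma nbhs_projlim_ball (x : projlim F) m :
  nbhs x [set y | projlim_ball F m (y - x)].
Proof.
suff H n : nbhs x [set y | forall k, (k < n)%N -> `|proj F k (y - x)| <= 2 ^- m].
  by apply: filterS (H m.+1) => y By k km; exact: By.
elim: n => [|n IH]; first by apply: filterE => y k; rewrite ltn0.
have Hn : \forall y \near x, `|proj F n x - proj F n y| <= 2 ^- m.
  have /cvgrPdist_le := @Defs.proj_continuous K F n x.
  by apply; rewrite invr_gt0 exprn_gt0.
apply: filterS2 IH Hn => y IH Hn k; rewrite ltnS leq_eqVlt => /orP[/eqP->|/IH//].
by rewrite linearB distrC.
Qed.

End projlim_ball.

(** * Boundedness, continuity and completeness *)

Section archimedean_normed.
Context {K : numFieldType} (arch : archimedean K).

(** If [S] is unbounded, its parts of norm above [n] generate a proper filter, which cannot cluster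
    at [a] since norms near [a] are bounded. *)
Lemma precompact_bounded (V : normedModType K) (S : set V) :
  precompact S -> exists n : nat, forall y, S y -> `|y| <= n%:R.
Proof.
rewrite precompactE => cS; apply: contrapT => unb.
pose C n := [set y | S y /\ n%:R < `|y|].
have Cn0 n : C n !=set0.
  apply: contrapT => Cn; apply: unb; exists n => y Sy.
  by rewrite real_leNgt//; apply/negP => ny; apply: Cn; exists y.
have PC : ProperFilter (filter_from [set: nat] C).
  apply: filter_from_proper => //; apply: filter_from_filter; first by exists 0%N.
  move=> i j _ _; exists (maxn i j) => // y [Sy my].
  by split; split=> //; apply: le_lt_trans my; rewrite ler_nat ?leq_maxl ?leq_maxr.
have [|a [_ aC]] := cS _ PC.
  by exists 0%N => // y [Sy _]; exact: subset_closure.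
have [n an] := arch (`|a| + 1) (addr_ge0 (normr_ge0 _) ler01).
have [z [[_ nz]]] : C n `&` ball a 1 !=set0.
  by apply: aC; [exists n|exact: nbhsx_ballx ltr01].
rewrite -ball_normE /ball_ /= => az.
suff : `|z| < n%:R by move/(lt_trans nz); rewrite ltxx.
rewrite (lt_le_trans _ an)//.
rewrite -(subrK a z) (le_lt_trans (ler_normD _ _))// addrC ltrD2l distrC//.
Qed.

(** Gives the continuity of [emb], by which coordinatewise limits are compatible; it comes from
    boundedness on the unit ball. *)
Lemma compact_linear_continuous (V W : normedModType K) (T : {linear V -> W}) :
  compact_linear T -> continuous T.
Proof.
move=> /precompact_bounded[n Tn]; apply/linear_bounded_continuous/ex_bound.
exists n%:R; apply: filterS (nbhsx_ballx (0 : V) 1 ltr01) => x.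
rewrite -ball_normE /ball_ /= sub0r normrN => /ltW x1.
by apply: Tn; exists x.
Qed.

(** The bound starts at rank [k] because [projlim_ball F n] controls the norm of [F k] only for
    [k <= n]. *)
Lemma cauchy_pow2_cvg (V : completeNormedModType K) (x : nat -> V) (k : nat) :
    (forall n p, (k <= n)%N -> `|x (n + p)%N - x n| <= 2 ^- n) ->
  exists l : V, x n @[n --> \oo] --> l.
Proof.
move=> xP; suff : cvg (x @ \oo) by move=> cx; exists (lim (x @ \oo)).
apply: cauchy_cvg; apply: cauchy_exP => e e0.
have [n ne] := archimedean_pow2 K arch (e / 2) (divr_gt0 e0 (ltr0Sn _ _)).
exists (x (maxn k n)); exists (maxn k n) => // p /= np.
rewrite -ball_normE /ball_ /= distrC -(subnKC np).
rewrite (le_lt_trans (xP _ _ (leq_maxl _ _)))//.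
rewrite (le_lt_trans (ler_pow2V _ _ (leq_maxr k n)))// (le_lt_trans ne)//.
by rewrite ltr_pdivrMr// ltr_pMr// ltr1n.
Qed.

Lemma cvg_dist_le (V : normedModType K) (x : nat -> V) (l : V) n (e : K) :
    x n @[n --> \oo] --> l -> (forall p, `|x (n + p)%N - x n| <= e) ->
  `|l - x n| <= e.
Proof.
move=> xl xe; apply/ler_addgt0Pr => d d0.
have /cvgrPdist_le/(_ d d0)[N _ Np] := xl.
have := Np (n + N)%N (leq_addl _ _) => /= H.
by rewrite -(subrKA (x (n + N)%N)) (le_trans (ler_normD _ _))// addrC lerD.
Qed.

(** Limits exist in every [F k]; continuity of [emb] and uniqueness of limits glue them into one
    point. *)
Lemma projlim_complete (F : nested_compact_seq K) (x : nat -> projlim F) :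
    (forall n p, projlim_ball F n (x (n + p)%N - x n)) ->
  exists l : projlim F, x n @[n --> \oo] --> l.
Proof.
move=> xP.
have cl k : exists l : F k, proj F k (x n) @[n --> \oo] --> l.
  apply: (@cauchy_pow2_cvg (F k) (proj F k \o x) k) => n p kn /=.
  by rewrite -linearB xP.
pose l k := sval (cid (cl k)).
have lP k : proj F k (x n) @[n --> \oo] --> l k := svalP (cid (cl k)).
have lE k : emb F k (l k.+1) = l k.
  have cE := compact_linear_continuous _ _ _ (@emb_compact _ F k) (l k.+1).
  apply: (cvg_unique (@norm_hausdorff K (F k))) (lP k).
  have -> : (fun n => proj F k (x n)) = emb F k \o (proj F k.+1 \o x).
    by apply/funext => n; rewrite /= [RHS]emb_pr.
  exact: cvg_comp (lP k.+1) cE.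
by exists (@Projlim K F l lE); apply/cvg_projlim => k; exact: lP.
Qed.

End archimedean_normed.

(** * From compactness and Baire to the closed range *)

Section closed_range.
Context {K : numFieldType} (arch : archimedean K) (E F : nested_compact_seq K).
Context (Fsharp : topologicalLmodType K) (j : tvs_pair Fsharp (projlim F)).
Context (P : pair_map (projlim_pair E) j).
Hypotheses (hF : hausdorff_space Fsharp) (PH : property_H' P).

(** The image of [C] under [g] is compact, hence closed in the Hausdorff space [Fsharp], and [j] is
    continuous. *)
Lemma closed_preimage_compact (T : topologicalType) (g : T -> Fsharp) (C : set T) :
  continuous g -> compact C -> closed [set f | exists2 w, C w & g w = j f].
Proof.
move=> cg cC.
have -> : [set f | exists2 w, C w & g w = j f] = j @^-1` (g @` C) by [].
apply: preimage_closed; first by move=> x _; exact: incl_continuous.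
by apply: compact_closed => //; apply: continuous_compact => //;
  exact: continuous_subspaceT.
Qed.

(* By (H'), the graph of [P] in [E 0 * F] is covered by the sets of points whose
   second component lies in [P (n C)], where [C] is the closure in [E 0] of the
   unit ball of [E 1].  As [C] is compact, these sets are closed, and Baire's
   theorem applies. *)
Lemma pair_map_lift_compact :
  exists (C : set (E 0%N)) (m : nat), compact C /\
    forall u f, P u = j f -> `|u| <= 2 ^- m -> projlim_ball F m f ->
      exists2 w, C w & P w = j f.
Proof.
pose X := (E 0%N * projlim F)%type.
pose C := closure (emb E 0 @` [set x | `|x| <= 1]).
have cC : compact C by rewrite -precompactE; exact: emb_compact.
pose G : set X := [set z | P z.1 = j z.2].
pose A n : set X := [set z | exists2 w, C w & P (n%:R *: w) = j z.2].
pose B m : set X := [set z | `|z.1| <= 2 ^- m /\ projlim_ball F m z.2].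
have cZ n : continuous (fun w : E 0%N => n%:R *: w) by move=> w; exact: cvgZl_tmp.
have cP n : continuous (fun w : E 0%N => P (n%:R *: w)).
  move=> w; apply: cvg_comp (cZ n w) _.
  exact: (@map_sharp_continuous _ _ _ _ _ _ _ P (n%:R *: w)).
have [|||x m Gx mx cx|n x Gx nAx|x Gx|n [x [m [Gx xA]]]] := baire_zmod X G B A.
- by rewrite /G /= !linear0.
- by move=> n; split; [rewrite normr0 invr_ge0 exprn_ge0|exact: projlim_ball0].
- move=> n x y [x1 x2] [y1 y2]; split; last exact: projlim_ballD.
  by rewrite /= (le_trans (ler_normD _ _))// -pow2V_double lerD.
- have [l1 xl1] : exists l : E 0%N, (x n).1 @[n --> \oo] --> l.
    apply: (cauchy_pow2_cvg arch _ (fun n => (x n).1) 0%N) => n p _.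
    by rewrite (le_trans (cx n p).1)// ler_pow2V.
  have [l2 xl2] : exists l : projlim F, (x n).2 @[n --> \oo] --> l.
    apply: projlim_complete => // n p.
    exact: projlim_ball_le (mx n) (cx n p).2.
  exists (l1, l2).
    have c1 : P (x n).1 @[n --> \oo] --> P l1.
      by apply: cvg_comp xl1 _; exact: map_sharp_continuous.
    apply: (cvg_unique hF c1).
    have -> : (fun n => P (x n).1) = (fun n => j (x n).2) by exact/funext.
    by apply: cvg_comp xl2 _; exact: incl_continuous.
  move=> n; split; first by apply: cvg_dist_le xl1 _ => p; exact: (cx n p).1.
  move=> k km; rewrite linearB.
  apply: (@cvg_dist_le _ _ (fun n => proj F k (x n).2)) => [|p].
    exact: (cvg_projlim _ _).1 xl2 k.
  by rewrite -linearB; exact: (cx n p).2.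
(* [A n] constrains only the second component, so a neighbourhood in [projlim F] suffices. *)
- have /closed_openC oD := closed_preimage_compact _ _ _ (cP n) cC.
  have [m mD] := projlim_ball_basis F x.2 _ arch (open_nbhs_nbhs (conj oD nAx)).
  by exists m => y _ [_ yx]; exact: mD yx.
- have [v Pv] := PH x.1 (ex_intro2 _ _ x.2 I (esym Gx)).
  (* Taking [n.+1] keeps the scaling factor invertible even when [n] is [0]. *)
  have [n vn] := arch `|proj E 1 v| (normr_ge0 _); exists n.+1.
  have n0 : n.+1%:R != 0 :> K by rewrite pnatr_eq0.
  exists (emb E 0 (n.+1%:R^-1 *: proj E 1 v)).
    apply: subset_closure; eexists; last reflexivity.
    rewrite /= normrZ ger0_norm ?invr_ge0// mulrC ler_pdivrMr// mul1r.
    by rewrite (le_trans vn)// ler_nat.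
  have -> : n.+1%:R *: emb E 0%N (n.+1%:R^-1 *: proj E 1 v) = proj E 0 v.
    by rewrite linearZ_LR scalerA divff// scale1r; exact: emb_pr.
  by rewrite -Gx Pv.
(* Baire gives a neighbourhood of some [x], not of [0]; subtracting a lift of [x] from a lift of
   [x + (u, f)] recentres it. *)
exists ((fun w => n%:R *: (w.1 - w.2)) @` (C `*` C)), m; split.
  apply: continuous_compact (compact_setX cC cC).
  apply: continuous_subspaceT => w.
  apply: cvgZl_tmp; apply: cvgB; [exact: cvg_fst|exact: cvg_snd].
move=> u f Puf um fm.
have [||w1 Cw1 w1E] := xA (x + (u, f)).
- by rewrite /G /= !linearD Puf Gx.
- by rewrite addrAC subrr add0r.
have [||w2 Cw2 w2E] := xA x => //.
- rewrite subrr; split; first by rewrite normr0 invr_ge0 exprn_ge0.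
  exact: projlim_ball0.
exists (n%:R *: (w1 - w2)); first by exists (w1, w2).
by rewrite scalerBr linearB w1E w2E -linearB addrAC subrr add0r.
Qed.

(* Off the open set [ker P + ball 0 (2 ^- m.+1)] the compact set [C] avoids
   [ker P], so its image stays away from [0]; hence a small [f] has a preimage
   which is twice smaller than requested.  Iterating this on [2^-1 *: f] removes the
   bound on [u]. *)
Lemma pair_map_range_small (C : set (E 0%N)) (m : nat) : compact C ->
    (forall u f, P u = j f -> `|u| <= 2 ^- m -> projlim_ball F m f ->
      exists2 w, C w & P w = j f) ->
  exists m', forall u f, P u = j f -> projlim_ball F m' f ->
    exists2 w, C w & P w = j f.
Proof.
move=> cC CP.
pose O := \bigcup_(n in [set n | P n = 0]) ball n (2 ^- m.+1).
have oO : open O by apply: bigcup_open => n _; exact: ball_open.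
have cS : compact (C `&` ~` O) by apply: compact_closedI => //; exact: open_closedC.
have /closed_openC oD :=
  closed_preimage_compact _ _ _ (@map_sharp_continuous _ _ _ _ _ _ _ P) cS.
have D0 : ~ exists2 w, (C `&` ~` O) w & P w = j 0.
  move=> [w [Cw nOw]]; rewrite linear0 => Pw.
  by apply: nOw; exists w => //; apply: ballxx; rewrite invr_gt0 exprn_gt0.
have [k kD] := projlim_ball_basis F 0 _ arch (open_nbhs_nbhs (conj oD D0)).
exists (maxn m k).
have step u f : P u = j f -> projlim_ball F (maxn m k) f -> `|u| <= 2 ^- m ->
    exists2 u', P u' = j f & `|u'| <= 2 ^- m.+1.
  move=> Puf fmk um.
  have fm := projlim_ball_le _ _ _ _ (leq_maxl m k) fmk.
  have fk := projlim_ball_le _ _ _ _ (leq_maxr m k) fmk.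
  have [w Cw Pw] := CP u f Puf um fm.
  (* If [w] is close to a kernel point [n], then [w - n] is a small preimage; otherwise [w]
     contradicts [kD]. *)
  have [[n Pn]|nOw] := pselect (O w).
    rewrite -ball_normE /ball_ /= distrC => /ltW nw.
    by exists (w - n) => //; rewrite linearB Pn subr0.
  by have [] := kD f; rewrite ?subr0//; exists w.
have halving N : forall u f, P u = j f -> projlim_ball F (maxn m k) f ->
    `|u| <= 2 ^+ N * 2 ^- m -> exists2 u', P u' = j f & `|u'| <= 2 ^- m.
  elim: N => [|N IH] u f Puf fmk uN; first by exists u => //; rewrite mul1r in uN.
  have half0 : 0 <= 2^-1 :> K by rewrite invr_ge0.
  have [|||u1 Pu1 u1m] := IH (2^-1 *: u) (2^-1 *: f).
  + by rewrite !linearZ_LR Puf.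
  + exact: projlim_ball_half.
  + by rewrite normrZ ger0_norm// ler_pdivrMl// mulrA -exprS.
  (* The factor gained by [step] pays for doubling back from [2^-1 *: f] to [f]. *)
  have [u2 Pu2 u2m] := step _ _ Pu1 (projlim_ball_half _ _ _ fmk) u1m.
  exists (2 *: u2).
    by rewrite linearZ_LR Pu2 -linearZ_LR scalerA divff ?scale1r// pnatr_eq0.
  rewrite normrZ ger0_norm// (le_trans (ler_wpM2l _ u2m))//.
  by rewrite exprS invfM mulrA divff ?mul1r// pnatr_eq0.
move=> u f Puf fmk.
have m0 : 0 < 2 ^- m :> K by rewrite invr_gt0 exprn_gt0.
have [n un] := arch (`|u| / 2 ^- m) (divr_ge0 (normr_ge0 _) (ltW m0)).
have [|u' Pu' u'm] := halving n u f Puf fmk.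
  rewrite -ler_pdivrMr// (le_trans un)//.
  by rewrite -natrX ler_nat ltnW// ltn_expl.
exact: CP u' f Pu' u'm (projlim_ball_le _ _ _ _ (leq_maxl m k) fmk).
Qed.

Lemma pair_map_closed_range : closed (range (map_ind P)).
Proof.
have [C [m [cC CP]]] := pair_map_lift_compact.
have [k kP] := pair_map_range_small C m cC CP.
have cD := closed_preimage_compact _ _ _ (@map_sharp_continuous _ _ _ _ _ _ _ P) cC.
move=> f clf.
(* With index [k.+1], two points this close to [f] differ by an element of the ball of index [k],
   where [kP] applies. *)
have [g [[v _ <-] gf]] := clf _ (nbhs_projlim_ball F f k.+1).
have [w Cw Pw] : exists2 w, C w & P w = j (f - map_ind P v).
  (* The closed trace of [P(C)] contains points [map_ind P v' - map_ind P v] arbitrarily close to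
     [f - map_ind P v]. *)
  apply: cD => U fU.
  have [n nU] := projlim_ball_basis F _ _ arch fU.
  have [_ [[v' _ <-] [nf hf]]] :=
    clf _ (filterI (nbhs_projlim_ball F f n) (nbhs_projlim_ball F f k.+1)).
  exists (map_ind P v' - map_ind P v); split; last first.
    by apply: nU; rewrite opprB addrA subrK.
  apply: (kP (proj E 0 (v' - v))).
    by rewrite (map_indE P (v' - v)) linearB.
  rewrite -(subrKA f); apply: projlim_ballD => //.
  by rewrite -opprB; exact: projlim_ballN.
have [|v' Pv'] := PH (w + proj E 0 v).
  by exists f => //; rewrite linearD Pw (map_indE P v) -linearD subrK.
exists v' => //; apply: (@incl_inj _ _ _ j).
by rewrite -map_indE -Pv' linearD Pw (map_indE P v) -linearD subrK.
Qed.

End closed_range.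

Theorem theorem4p4 (R : realType) (K : numFieldType)
    (KRC : K = (R : numFieldType) \/ K = (R[i]%C : numFieldType))
    (E F : nested_compact_seq K) (Fsharp : topologicalLmodType K)
    (FsharpF : tvs_pair Fsharp (projlim F))
    (P : pair_map (projlim_pair E) FsharpF) :
  hausdorff_space Fsharp -> property_H' P ->
  closed (range (map_ind P)).
Proof.
apply: pair_map_closed_range; case: KRC => ->.
  exact: archimedean_realType.
exact: archimedean_complex.
Qed.
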